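(* Let $\mathsf{Q}$ be a continuous and integral quantale such that $\&$ distributes over non-empty meets, and let $X$ be a $\mathsf{Q}$-category. (i) If $X$ is Yoneda complete, then each directed subset $(x_\lambda,r_\lambda)_{\lambda\in D}$ of $\mathbf{B}X$ with $\bigvee_{\lambda\in D}r_\lambda=1$ has a join. (ii) If $X$ has property (R) and $\mathbf{B}X$ is directed complete, then $X$ is Yoneda complete.
   Context: A quantale $\mathsf{Q}=(\mathsf{Q},\&,k)$ here is a commutative monoid with unit $k$ whose underlying set is a complete lattice (top $1$, bottom $0$) such that $p\,\&\,\bigvee_{i}q_i=\bigvee_{i}p\,\&\,q_i$ for all $p,q_i\in\mathsf{Q}$. It is integral if $k=1$. The implication $\to$ is determined by $p\,\&\,q\le r\iff q\le p\to r$. For elements $a,b$ of a partially ordered set, $a\ll b$ ($a$ is way below $b$) if for each directed set $D$ having a join, $b\le\bigvee D$ implies $a\le d$ for some $d\in D$. $\mathsf{Q}$ is continuous if its underlying lattice is a continuous lattice, i.e. $a=\bigvee\{x\mid x\ll a\}$ for every $a\in\mathsf{Q}$. $\&$ distributes over non-empty meets if $p\,\&\,\bigwedge_{i\in I}q_i=\bigwedge_{i\in I}p\,\&\,q_i$ for every $p\in\mathsf{Q}$ and every non-empty family $(q_i)_{i\in I}$ in $\mathsf{Q}$. A $\mathsf{Q}$-category is a set $X$ with a map $X\times X\to\mathsf{Q}$, $(x,y)\mapsto X(x,y)$, such that $k\le X(x,x)$ and $X(y,z)\,\&\,X(x,y)\le X(x,z)$ for all $x,y,z\in X$. A formal ball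 of $X$ is a pair $(x,r)$ with $x\in X$, $r\in\mathsf{Q}$ (the radius $r$ may be $0$). $\mathbf{B}X$ is the set of all formal balls with the preorder: $(x,r)\le(y,s)$ iff $r\le s\,\&\,X(x,y)$. $\mathbf{B}X$ is directed complete if each directed (in particular non-empty) subset has a join; a join in a preordered set is a least upper bound (unique only up to equivalence). A directed subset of $\mathbf{B}X$ is written as a family $(x_\lambda,r_\lambda)_{\lambda\in D}$ indexed by itself, so $\lambda\le\mu$ in $D$ means $(x_\lambda,r_\lambda)\le(x_\mu,r_\mu)$. A net $(x_\lambda)_{\lambda\in D}$ in $X$ is forward Cauchy if $\bigvee_\lambda\bigwedge_{\lambda\le\gamma\le\mu}X(x_\gamma,x_\mu)\ge k$. An element $a\in X$ is a Yoneda limit of $(x_\lambda)_{\lambda\in D}$ if $X(a,y)=\bigvee_\lambda\bigwedge_{\mu\ge\lambda}X(x_\mu,y)$ for all $y\in X$. $X$ is Yoneda complete if every forward Cauchy net in $X$ has a Yoneda limit. Property (R) for a $\mathsf{Q}$-category $X$ ($\mathsf{Q}$ continuous and integral): for each pair $(s,t)$ of elements of $\mathsf{Q}$ with $0<s\le t$, there is some $r\ll1$ such that for all $x,y\in X$ and all $r'\ge r$, one has $(x,t\,\&\,r')\le(y,s)\iff(x,r')\le(y,t\to s)$ in $\mathbf{B}X$. *)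

(* Defs.v *)
From HB Require Import structures.
From mathcomp Require Import all_boot all_order.
From mathcomp Require Import boolp classical_sets.

Set Implicit Arguments.
Unset Strict Implicit.
Unset Printing Implicit Defensive.

Import Order.TTheory.
Local Open Scope classical_set_scope.
Local Open Scope order_scope.

(* Orders are boolean and live on choiceTypes; with the classical axioms of
   mathcomp.classical this is no restriction, since [asbool] turns any order
   into a boolean one and [gen_choiceMixin] applies to any type. *)

Section Preorders.
Context {d : Order.disp_t} {T : preorderType d}.
Implicit Types (A : set T) (a b x : T).

Definition directed A : Prop :=
  A !=set0 /\
  forall a b, A a -> A b -> exists c, [/\ A c, a <= c & b <= c].

(* [supremums] of classical_sets, which needs a partial order; in a preorder
   the join is only unique up to equivalence. *)
Definition is_join A x : Prop :=
  (forall a, A a -> a <= x) /\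
  (forall y, (forall a, A a -> a <= y) -> x <= y).

End Preorders.

Definition directed_complete d (T : preorderType d) : Prop :=
  forall A : set T, directed A -> exists x, is_join A x.

Definition way_below d (T : porderType d) (a b : T) : Prop :=
  forall (D : set T) (s : T),
    directed D -> supremums D s -> b <= s -> exists2 x, D x & a <= x.

HB.mixin Record isCompleteLattice (d : Order.disp_t) T
    of Order.TBLattice d T := {
  bigjoin : set T -> T;
  bigjoinP : forall A : set T, supremums A (bigjoin A)
}.

#[short(type="completeLatticeType")]
HB.structure Definition CompleteLattice (d : Order.disp_t) :=
  { T of Order.TBLattice d T & isCompleteLattice d T }.

Definition bigmeet d (L : completeLatticeType d) (A : set L) : L :=
  bigjoin (lbound A).

Lemma bigmeetP d (L : completeLatticeType d) (A : set L) :
  infimums A (bigmeet A).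
Proof.
have [ubA lubA] := bigjoinP (lbound A).
by split=> // x Ax; apply: lubA => y; apply.
Qed.

Definition continuous_lattice d (L : completeLatticeType d) : Prop :=
  forall a : L, a = bigjoin [set x | way_below x a].

HB.mixin Record isQuantale (d : Order.disp_t) Q of CompleteLattice d Q := {
  qunit : Q;
  qmul : Q -> Q -> Q;
  qmulA : associative qmul;
  qmulC : commutative qmul;
  qmul1q : left_id qunit qmul;
  qmul_bigjoin : forall (p : Q) (A : set Q),
    qmul p (bigjoin A) = bigjoin (qmul p @` A)
}.

#[short(type="quantaleType")]
HB.structure Definition Quantale (d : Order.disp_t) :=
  { Q of CompleteLattice d Q & isQuantale d Q }.

HB.instance Definition _ d (Q : quantaleType d) :=
  Monoid.isComLaw.Build Q qunit qmul qmulA qmulC qmul1q.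

Section QuantaleTheory.
Context {d : Order.disp_t} {Q : quantaleType d}.
Implicit Types p q r : Q.

Definition qimpl p r : Q := bigjoin [set q | qmul p q <= r].

Lemma qmul_monor p q r : q <= r -> qmul p q <= qmul p r.
Proof.
move=> qr.
have E (x : Q) : bigjoin [set y | y <= x] = x.
  have [ub lub] := bigjoinP [set y | y <= x].
  by apply/le_anti/andP; split; [apply: lub => y|apply: ub => /=].
rewrite -(E r) qmul_bigjoin.
by apply: (bigjoinP _).1; exists q.
Qed.

Lemma qimplP p q r : (qmul p q <= r) <-> (q <= qimpl p r).
Proof.
split=> [pqr|qpr]; first exact: (bigjoinP _).1.
apply: (le_trans (qmul_monor p qpr)); rewrite qmul_bigjoin.
by apply: (bigjoinP _).2 => _ [y /= ? <-].
Qed.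

End QuantaleTheory.

Definition integral d (Q : quantaleType d) : Prop := qunit = \top :> Q.

Definition distributes_over_nonempty_meets d (Q : quantaleType d) : Prop :=
  forall (p : Q) (A : set Q), A !=set0 ->
    qmul p (bigmeet A) = bigmeet (qmul p @` A).

Record qcategory d (Q : quantaleType d) := QCategory {
  qobj :> Type;
  qhom : qobj -> qobj -> Q;
  qhom_refl : forall x, qunit <= qhom x x;
  qhom_trans : forall x y z, qmul (qhom y z) (qhom x y) <= qhom x z
}.

Record formal_ball d (Q : quantaleType d) (X : qcategory Q) :=
  Ball { center : X; radius : Q }.

Fact ball_display (d : Order.disp_t) : Order.disp_t.
Proof. exact: d. Qed.

Section FormalBalls.
Context {d : Order.disp_t} {Q : quantaleType d} {X : qcategory Q}.

HB.instance Definition _ := gen_eqMixin (formal_ball X).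
HB.instance Definition _ := gen_choiceMixin (formal_ball X).

Definition ball_le (b c : formal_ball X) : bool :=
  radius b <= qmul (radius c) (qhom (center b) (center c)).

Fact ball_le_refl : reflexive ball_le.
Proof.
move=> [x r]; rewrite /ball_le /= -{1}[r]qmul1q qmulC.
exact/qmul_monor/qhom_refl.
Qed.

Fact ball_le_trans : transitive ball_le.
Proof.
move=> [y s] [x r] [z t]; rewrite /ball_le /= => rs st.
apply: (le_trans rs); rewrite qmulC; apply: (le_trans (qmul_monor _ st)).
by rewrite qmulC -qmulA; apply/qmul_monor/qhom_trans.
Qed.

HB.instance Definition _ :=
  Order.Le_isPreorder.Build (ball_display d) (formal_ball X)
    ball_le_refl ball_le_trans.

End FormalBalls.

Section YonedaCompleteness.
Context {d : Order.disp_t} {Q : quantaleType d} (X : qcategory Q).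

Definition forward_cauchy d' (D : preorderType d') (x : D -> X) : Prop :=
  qunit <= bigjoin (range (fun l : D =>
    bigmeet [set q : Q | exists g m : D,
      [/\ l <= g, g <= m & q = qhom (x g) (x m)]])).

Definition yoneda_limit d' (D : preorderType d') (x : D -> X) (a : X) : Prop :=
  forall y : X, qhom a y = bigjoin (range (fun l : D =>
    bigmeet [set q : Q | exists2 m : D, l <= m & q = qhom (x m) y])).

Definition yoneda_complete : Prop :=
  forall (d' : Order.disp_t) (D : preorderType d') (x : D -> X),
    directed [set: D] -> forward_cauchy x -> exists a : X, yoneda_limit x a.

Definition property_R : Prop :=
  forall s t : Q, \bot < s -> s <= t ->
    exists2 r : Q, way_below r \top &
      forall (x y : X) (r' : Q), r <= r' ->
        (Ball x (qmul t r') <= Ball y s) <-> (Ball x r' <= Ball y (qimpl t s)).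

End YonedaCompleteness.

(* Main.v *)
(* (i) If the radii of a directed set of balls have join 1, its centers form a
   forward Cauchy net, and a Yoneda limit [a] of it gives the join [(a, 1)].
   (ii) For a forward Cauchy net with Cauchy tails [r_l], the balls [(x_l, r)]
   with [r] way below [r_l] form a directed set, whose join must be of the form
   [(b, 1)].  By property (R), used only for [s = t], scaling all radii by
   [t > 0] turns this join into [(b, t)].  Since [(b, t) <= (y, 1)] means
   [t <= X(b, y)], taking for [t] the join of the meets of the tails
   [X(x_m, y)] shows that [b] is a Yoneda limit. *)
From HB Require Import structures.
Require Import Defs.
From mathcomp Require Import all_boot all_order.
From mathcomp Require Import boolp classical_sets.

Set Implicit Arguments.
Unset Strict Implicit.
Unset Printing Implicit Defensive.

Import Order.TTheory.
Local Open Scope classical_set_scope.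
Local Open Scope order_scope.

(** * Way-below relation and continuity *)

Section CompleteLattices.
Context {d : Order.disp_t} {L : completeLatticeType d}.
Implicit Types (a b r x y : L) (A : set L).

Lemma bigjoin_ub A x : A x -> x <= bigjoin A.
Proof. exact: (bigjoinP A).1. Qed.

Lemma bigjoin_le A y : (forall x, A x -> x <= y) -> bigjoin A <= y.
Proof. exact: (bigjoinP A).2. Qed.

Lemma bigmeet_lb A x : A x -> bigmeet A <= x.
Proof. exact: (bigmeetP A).1. Qed.

Lemma bigmeet_ge A y : (forall x, A x -> y <= x) -> y <= bigmeet A.
Proof. exact: (bigmeetP A).2. Qed.

Lemma way_below_le a b : way_below a b -> a <= b.
Proof.
move=> /(_ [set b] b); case=> //; last by move=> _ ->.
- by split; [exists b | move=> _ _ -> ->; exists b].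
- by split=> [_ ->|y]; [|apply].
Qed.

Lemma way_below_trans a b c : way_below a b -> b <= c -> way_below a c.
Proof. by move=> ab bc D s dD sD cs; apply: ab dD sD (le_trans bc cs). Qed.

Lemma way_below_bot b : way_below \bot b.
Proof. by move=> D s [[x Dx] _] _ _; exists x; rewrite ?le0x. Qed.

Lemma way_below_join a a' b :
  way_below a b -> way_below a' b -> way_below (a `|` a') b.
Proof.
move=> ab a'b D s dD sD bs.
have [x Dx ax] := ab D s dD sD bs; have [y Dy ay] := a'b D s dD sD bs.
have [z [Dz xz yz]] := dD.2 _ _ Dx Dy.
by exists z; rewrite // leUx (le_trans ax) ?(le_trans ay).
Qed.

Lemma way_below_bigjoin a b A :
  way_below a b -> directed A -> b <= bigjoin A -> exists2 x, A x & a <= x.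
Proof. by move=> ab dA; apply: ab dA (bigjoinP A). Qed.

Lemma continuous_le a b :
  continuous_lattice L -> (forall r, way_below r a -> r <= b) -> a <= b.
Proof. by move=> cL ab; rewrite (cL a); apply: bigjoin_le. Qed.

End CompleteLattices.

(** * Multiplication in a quantale *)

Section Quantales.
Context {d : Order.disp_t} {Q : quantaleType d}.
Implicit Types (p q r : Q) (A : set Q).

Lemma qmul_mono p p' q q' : p <= p' -> q <= q' -> qmul p q <= qmul p' q'.
Proof.
move=> pp qq; apply: (le_trans (qmul_monor p qq)).
by rewrite qmulC [leRHS]qmulC qmul_monor.
Qed.

Lemma qmul_bigjoin_le p A r :
  (forall q, A q -> qmul p q <= r) -> qmul p (bigjoin A) <= r.
Proof.
by move=> Ar; rewrite qmul_bigjoin; apply: bigjoin_le => _ [q /Ar ? <-].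
Qed.

Lemma directed_qmul p A : directed A -> directed (qmul p @` A).
Proof.
move=> [[a Aa] dA]; split; first by exists (qmul p a), a.
move=> _ _ [x Ax <-] [y Ay <-]; have [z [Az xz yz]] := dA _ _ Ax Ay.
by exists (qmul p z); split; [exists z | exact: qmul_monor..].
Qed.

Hypothesis intQ : integral Q.

Lemma qmult1 p : qmul p \top = p.
Proof. by rewrite -intQ qmulC qmul1q. Qed.

Lemma qmul_lel p q : qmul p q <= p.
Proof. by rewrite -[leRHS]qmult1 qmul_monor ?lex1. Qed.

Lemma qmul_ler p q : qmul p q <= q.
Proof. by rewrite qmulC qmul_lel. Qed.

Lemma qimplxx p : qimpl p p = \top.
Proof. by apply/eqP; rewrite -le1x; apply/qimplP; rewrite qmult1. Qed.

End Quantales.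

(** * Comparison of formal balls over an integral quantale *)

Section Balls.
Context {d : Order.disp_t} {Q : quantaleType d} {X : qcategory Q}.
Hypothesis intQ : integral Q.
Implicit Types (b c : formal_ball X) (x y : X).

Lemma ball_leE x y (r s : Q) :
  (Ball x r <= Ball y s) = (r <= qmul s (qhom x y)).
Proof. by []. Qed.

Lemma ball_le_top x y (r : Q) : (Ball x r <= Ball y \top) = (r <= qhom x y).
Proof. by rewrite ball_leE qmulC qmult1. Qed.

Lemma radius_mono b c : b <= c -> radius b <= radius c.
Proof.
by case: b c => [x r] [y s]; rewrite ball_leE => /le_trans-> //; apply: qmul_lel.
Qed.

Lemma radius_le_hom b c : b <= c -> radius b <= qhom (center b) (center c).
Proof.
by case: b c => [x r] [y s]; rewrite ball_leE => /le_trans-> //; apply: qmul_ler.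
Qed.

End Balls.

(** * Tails of nets *)

Section Nets.
Context {d : Order.disp_t} {Q : quantaleType d} {X : qcategory Q}.
Context {d' : Order.disp_t} {D : preorderType d'} (x : D -> X).
Implicit Types (a y : X) (l m : D).

(** This and the next two definitions name subterms of [forward_cauchy] and [yoneda_limit] and are
    convertible to them. *)
Definition cauchy_tail l : Q :=
  bigmeet [set q | exists g m, [/\ l <= g, g <= m & q = qhom (x g) (x m)]].

Definition hom_tail y l : Q :=
  bigmeet [set q | exists2 m, l <= m & q = qhom (x m) y].

Definition liminf_hom y : Q := bigjoin (range (hom_tail y)).

Lemma cauchy_tail_mono l m : l <= m -> cauchy_tail l <= cauchy_tail m.
Proof.
move=> lm; apply: bigmeet_ge => _ [g [n [mg gn ->]]]; apply: bigmeet_lb.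
by exists g, n; split=> //; apply: le_trans mg.
Qed.

Lemma cauchy_tail_le l m : l <= m -> cauchy_tail l <= qhom (x l) (x m).
Proof. by move=> lm; apply: bigmeet_lb; exists l, m. Qed.

Lemma hom_tail_le y l m : l <= m -> hom_tail y l <= qhom (x m) y.
Proof. by move=> lm; apply: bigmeet_lb; exists m. Qed.

(** For each tail index [n], pick [m] above [l] and [n] and compose through [x m]. Both directions
    of the theorem use this, with [p] the radius of a ball centered at [x l]. *)
Lemma qmul_liminf_hom_le (p : Q) y l : directed [set: D] ->
  (forall m, l <= m -> p <= qhom (x l) (x m)) ->
  qmul p (liminf_hom y) <= qhom (x l) y.
Proof.
move=> [_ dD] pl; apply: qmul_bigjoin_le => _ [n _ <-].
have [m [_ lm nm]] := dD l n I I.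
apply: le_trans (qhom_trans (x l) (x m) y); rewrite qmulC.
by apply: qmul_mono (pl m lm); apply: hom_tail_le.
Qed.

End Nets.

(** * A directed set of balls as a net indexed by itself *)

Section SetOfBallsAsNet.
Context {d : Order.disp_t} {Q : quantaleType d} {X : qcategory Q}.
Variable A : set (formal_ball X).

(** Boolean membership makes this a subtype that inherits the choice structure required of an index
    preorder. *)
Definition ball_index := {b : formal_ball X | b \in A}.

HB.instance Definition _ := SubChoice.on ball_index.

Definition ball_index_le (i j : ball_index) : bool := val i <= val j.

Fact ball_index_le_refl : reflexive ball_index_le.
Proof. by move=> i; apply: lexx. Qed.

Fact ball_index_le_trans : transitive ball_index_le.
Proof. by move=> j i k; apply: le_trans. Qed.

HB.instance Definition _ :=
  Order.Le_isPreorder.Build (ball_display d) ball_index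
    ball_index_le_refl ball_index_le_trans.

Lemma ball_indexP (i : ball_index) : A (val i).
Proof. by have := valP i; rewrite inE. Qed.

Lemma ball_index_ex b : A b -> exists i : ball_index, val i = b.
Proof. by move=> Ab; exists (exist _ b (mem_set Ab)). Qed.

Lemma directed_ball_index : directed A -> directed [set: ball_index].
Proof.
move=> [[b /ball_index_ex[i _]] dA]; split; first by exists i.
move=> j k _ _; have [c [Ac jc kc]] := dA _ _ (ball_indexP j) (ball_indexP k).
have [n nc] := ball_index_ex Ac.
by exists n; split=> //; rewrite /Order.le /= /ball_index_le nc.
Qed.

End SetOfBallsAsNet.

(** * From Yoneda limits to joins of balls *)

Lemma yoneda_complete_ball_join d (Q : quantaleType d) (X : qcategory Q)
    (A : set (formal_ball X)) :
  integral Q -> yoneda_complete X -> directed A ->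
  bigjoin [set radius b | b in A] = \top -> exists b, is_join A b.
Proof.
move=> intQ ycX dA A1; pose x (i : ball_index A) := center (val i).
have dI := directed_ball_index dA.
have rx (i j : ball_index A) : i <= j -> radius (val i) <= qhom (x i) (x j).
  exact: radius_le_hom.
have cx : forward_cauchy x.
  rewrite /forward_cauchy (_ : qunit = \top) // -A1.
  apply: bigjoin_le => _ [b Ab <-]; have [i <-] := ball_index_ex Ab.
  apply: (@le_trans _ _ (cauchy_tail x i)); last by apply: bigjoin_ub; exists i.
  (* Radii increase along the order, so the radius at [i] is at most that at [g], hence at most
     X(x_g, x_m). *)
  apply: bigmeet_ge => _ [g [m [ig gm ->]]].
  by apply: le_trans (rx _ _ gm); apply: radius_mono.
have [a ax] := ycX _ _ x dI cx.
exists (Ball a \top); split=> [b Ab|[y s] ub].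
  have [i ib] := ball_index_ex Ab.
  (* Taking [y := a], the limit equation turns the liminf into X(a, a) = 1, which leaves r_i <=
     X(x_i, a). *)
  have := qmul_liminf_hom_le a dI (rx i).
  rewrite -[liminf_hom x a]ax (_ : qhom a a = \top); last first.
    by apply/eqP; rewrite -le1x -intQ qhom_refl.
  by rewrite qmult1 // /x ib; case: b {Ab ib} => z r; rewrite ball_le_top.
have s1 : s = \top.
  apply/eqP; rewrite -le1x -A1; apply: bigjoin_le => _ [b Ab <-].
  exact: (radius_mono intQ (ub b Ab)).
rewrite s1 ball_le_top // ax -A1; apply: bigjoin_le => _ [b Ab <-].
have [i <-] := ball_index_ex Ab.
apply: (@le_trans _ _ (hom_tail x y i)); last by apply: bigjoin_ub; exists i.
(* The upper bound is compared with ball [m], not [i]: r_i <= r_m <= X(x_m, y). *)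
apply: bigmeet_ge => _ [m im ->]; apply: (@le_trans _ _ (radius (val m))).
  exact: radius_mono.
exact: (radius_le_hom intQ (ub _ (ball_indexP m))).
Qed.

(** * From joins of balls to Yoneda limits *)

Section CauchyBalls.
Context {d : Order.disp_t} {Q : quantaleType d} {X : qcategory Q}.
Context {d' : Order.disp_t} {D : preorderType d'} (x : D -> X).
Hypotheses (contQ : continuous_lattice Q) (intQ : integral Q).
Hypotheses (dD : directed [set: D]) (cx : forward_cauchy x).

(* The balls [(x_l, cauchy_tail x l)] need not be directed; shrinking the radii
   to elements way below the tails repairs this. *)
Definition cauchy_balls : set (formal_ball X) :=
  [set b | exists2 l, center b = x l & way_below (radius b) (cauchy_tail x l)].

Lemma directed_cauchy_radii : directed (@radius _ _ X @` cauchy_balls).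
Proof.
have [[l _] dirD] := dD; split.
  exists \bot, (Ball (x l) \bot) => //.
  by exists l => //; apply: way_below_bot.
move=> _ _ [[z r] [i /= _ ri] <-] [[w s] [j /= _ sj] <-].
have [k [_ ik jk]] := dirD i j I I.
exists (r `|` s); split; rewrite ?leUl ?leUr //.
exists (Ball (x k) (r `|` s)) => //; exists k => //=.
apply/way_below_join; [apply/(way_below_trans ri) | apply/(way_below_trans sj)].
  exact: cauchy_tail_mono.
exact: cauchy_tail_mono.
Qed.

Lemma bigjoin_cauchy_radii : bigjoin (@radius _ _ X @` cauchy_balls) = \top.
Proof.
apply/eqP; rewrite -le1x -intQ; apply: (le_trans cx).
apply: bigjoin_le => _ [l _ <-]; apply: (continuous_le contQ) => r rl.
by apply: bigjoin_ub; exists (Ball (x l) r) => //; exists l.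
Qed.

(** The tail at [l] equals its product with 1, hence is the directed join of its products with the
    radii [t]; being way below it, [r] lies under one of these products. As the tail at [l] is below
    X(x_l, x_n'), this puts (x_l, r) under (x_n', t) for every n' >= l. *)
Lemma cauchy_ball_shrink l (r : Q) : way_below r (cauchy_tail x l) ->
  exists2 n, l <= n & exists2 t, way_below t (cauchy_tail x n) &
    r <= qmul (cauchy_tail x l) t.
Proof.
move=> rl.
have [|_ [_ [[z t] [m /= _ tm] <-] <-] rt] := way_below_bigjoin rl
  (directed_qmul (cauchy_tail x l) directed_cauchy_radii).
  by rewrite -qmul_bigjoin bigjoin_cauchy_radii qmult1.
have [n [_ ln mn]] := dD.2 l m I I; exists n => //; exists t => //.
exact/(way_below_trans tm)/cauchy_tail_mono.
Qed.

Lemma directed_cauchy_balls : directed cauchy_balls.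
Proof.
split; first by have [[_ [b Sb _]] _] := directed_cauchy_radii; exists b.
move=> [_ r] [_ s] [l /= -> rl] [m /= -> sm].
have [i li [t ti rt]] := cauchy_ball_shrink rl.
have [j mj [u uj su]] := cauchy_ball_shrink sm.
have [n [_ ik jk]] := dD.2 i j I I.
have le_ball k q v : k <= n -> q <= qmul (cauchy_tail x k) v ->
    v <= t `|` u -> Ball (x k) q <= Ball (x n) (t `|` u).
  move=> kn qv vtu; rewrite ball_leE (le_trans qv) // qmulC.
  by rewrite qmul_mono ?cauchy_tail_le.
exists (Ball (x n) (t `|` u)); split.
- exists n => //=; apply: way_below_join.
    exact/(way_below_trans ti)/cauchy_tail_mono.
  exact/(way_below_trans uj)/cauchy_tail_mono.
- by apply: le_ball rt _; rewrite ?leUl // (le_trans li).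
- by apply: le_ball su _; rewrite ?leUr // (le_trans mj).
Qed.

Lemma radius_cauchy_balls_ub (b : formal_ball X) :
  (forall c, cauchy_balls c -> c <= b) -> radius b = \top.
Proof.
move=> ub; apply/eqP; rewrite -le1x -bigjoin_cauchy_radii.
by apply: bigjoin_le => _ [c /ub cb <-]; apply: radius_mono.
Qed.

(** Property (R) speaks only of radii above some [r] way below 1; cofinality lets it reach every
    ball. *)
Lemma cauchy_balls_cofinal (r : Q) b : way_below r \top -> cauchy_balls b ->
  exists c, [/\ cauchy_balls c, b <= c & r <= radius c].
Proof.
move=> r1 Sb.
have [|_ [c Sc <-] rc] := way_below_bigjoin r1 directed_cauchy_radii.
  by rewrite bigjoin_cauchy_radii.
have [e [Se be ce]] := directed_cauchy_balls.2 _ _ Sb Sc.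
by exists e; split=> //; apply: le_trans rc (radius_mono intQ ce).
Qed.

Definition scale_ball (t : Q) (b : formal_ball X) :=
  Ball (center b) (qmul t (radius b)).

Lemma scale_ball_mono t b c : b <= c -> scale_ball t b <= scale_ball t c.
Proof.
by case: b c => [y r] [z s] bc; rewrite /scale_ball ball_leE -qmulA qmul_monor.
Qed.

Lemma directed_scale_cauchy_balls t : directed (scale_ball t @` cauchy_balls).
Proof.
have [[b Sb] dS] := directed_cauchy_balls.
split; first by exists (scale_ball t b), b.
move=> _ _ [e Se <-] [f Sf <-]; have [g [Sg eg fg]] := dS _ _ Se Sf.
by exists (scale_ball t g); split; [exists g | exact: scale_ball_mono..].
Qed.

Lemma property_R_scale_join t a :
  property_R X -> directed_complete (formal_ball X) -> \bot < t ->
  is_join cauchy_balls (Ball a \top) ->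
  is_join (scale_ball t @` cauchy_balls) (Ball a t).
Proof.
move=> RX dcX t0 [ub_a lub_a].
have scale_top z : scale_ball t (Ball z \top) = Ball z t.
  by rewrite /scale_ball /= qmult1.
have ub_ta b : (scale_ball t @` cauchy_balls) b -> b <= Ball a t.
  by move=> [c Sc <-]; rewrite -scale_top; apply/scale_ball_mono/ub_a.
split=> // c ubc.
have [[z s] [ub_z lub_z]] := dcX _ (directed_scale_cauchy_balls t).
(* [(a, t)] is an upper bound, so s <= t; conversely [s] bounds all products of [t] with radii, and
   these join to t. *)
have st : s = t.
  apply/le_anti/andP; split; first exact: (radius_mono intQ (lub_z _ ub_ta)).
  rewrite -[t](qmult1 intQ) -bigjoin_cauchy_radii.
  apply: qmul_bigjoin_le => _ [b Sb <-].
  by apply: (radius_mono intQ (ub_z (scale_ball t b) _)); exists b.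
subst s; have [r r1 Rr] := RX t t t0 (lexx t).
(* Since t -> t = 1, property (R) cancels [t] and makes [(z, 1)] an upper bound of the unscaled
   balls. *)
have az : Ball a \top <= Ball z \top.
  apply: lub_a => b Sb; have [[y r'] [Sc bc rr]] := cauchy_balls_cofinal r1 Sb.
  apply: (le_trans bc); have /= := (Rr y z r' rr).1; rewrite qimplxx //.
  by apply; apply: (ub_z (scale_ball t (Ball y r'))); exists (Ball y r').
apply: le_trans (lub_z c ubc).
by rewrite -!scale_top; apply: scale_ball_mono.
Qed.

Lemma property_R_yoneda_limit :
  property_R X -> directed_complete (formal_ball X) ->
  exists a, yoneda_limit x a.
Proof.
move=> RX dcX; have [[a s] ja] := dcX _ directed_cauchy_balls.
have s1 : s = \top := radius_cauchy_balls_ub ja.1.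
subst s; exists a => y; rewrite -[RHS]/(liminf_hom x y).
apply/le_anti/andP; split.
  rewrite -[leLHS](qmult1 intQ) -bigjoin_cauchy_radii.
  apply: qmul_bigjoin_le => _ [[z r] [l /= _ rl] <-].
  (* Every [q] way below the tail at [l] is way below the tail at [m], so (x_m, q) is one of the
     balls under (a, 1); continuity then gives the whole tail. *)
  have tail_le m : l <= m -> cauchy_tail x l <= qhom (x m) a.
    move=> lm; apply: (continuous_le contQ) => q ql; rewrite -ball_le_top //.
    apply: ja.1; exists m => //=.
    exact/(way_below_trans ql)/cauchy_tail_mono.
  apply: (@le_trans _ _ (hom_tail x y l)); last by apply: bigjoin_ub; exists l.
  apply: bigmeet_ge => _ [m lm ->]; apply: le_trans (qhom_trans (x m) a y).
  by apply/qmul_monor/(le_trans (way_below_le rl))/tail_le.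
(* Property (R) requires t > 0, so a liminf equal to 0 is treated apart. *)
have [->|t0] := eqVneq (liminf_hom x y) \bot; first exact: le0x.
rewrite -lt0x in t0; rewrite -ball_le_top //.
(* It suffices that (y, 1) bounds the balls scaled by the liminf. *)
apply: (property_R_scale_join RX dcX t0 ja).2 => _ [[_ r] [l /= -> rl] <-].
rewrite /scale_ball ball_le_top // qmulC; apply: qmul_liminf_hom_le => // m lm.
exact: le_trans (way_below_le rl) (cauchy_tail_le x lm).
Qed.

End CauchyBalls.

Theorem theorem4p2 (d : Order.disp_t) (Q : quantaleType d) (X : qcategory Q) :
  continuous_lattice Q ->
  integral Q ->
  distributes_over_nonempty_meets Q ->
  (yoneda_complete X ->
     forall A : set (formal_ball X),
       directed A ->
       bigjoin [set radius b | b in A] = \top ->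
       exists b : formal_ball X, is_join A b)
  /\
  (property_R X ->
     directed_complete (formal_ball X) ->
     yoneda_complete X).
Proof.
move=> contQ intQ _; split=> [ycX A dA A1|RX dcX d' D x dD cx].
  exact: yoneda_complete_ball_join.
exact: property_R_yoneda_limit.
Qed.
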